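(* Let $(X,G)$ be a transformation group, where $X$ is a nonempty compact Hausdorff space, let $\sigma : G \to \operatorname{Aut}(C(X))$ be the induced homomorphism $\sigma_g(f)(x) = f(g^{-1}.x)$, and let $C(X)\rtimes_\sigma G$ be the associated skew group algebra. Consider the following five assertions: (i) $C(X) \rtimes_\sigma G$ is a simple algebra; (ii) $C(X)$ is $G$-simple and $C(X)$ is a maximal commutative subalgebra of $C(X) \rtimes_\sigma G$; (iii) $C(X)$ is $G$-simple and the centre $Z(C(X) \rtimes_\sigma G)$ is a field; (iv) $C(X)$ is $G$-simple and $\sigma : G \to \operatorname{Aut}(C(X))$ is injective; (v) $(X,G)$ is minimal and faithful. The following conclusions hold: (a) (i) and (ii) are equivalent and imply (iii), (iv) and (v); (b) (iv) and (v) are equivalent; (c) in general (iii), (iv) and (v) do not imply (i) and (ii), i.e. there exists such a transformation group $(X,G)$ for which (iii), (iv) and (v) all hold but (i) and (ii) fail; (d) if $G$ is an abelian group, then (i), (ii), (iii), (iv) and (v) are all equivalent.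
   Context: A transformation group $(X,G)$ consists of a topological group $G$ (neutral element $e$) acting on a compact Hausdorff space $X$ such that the map $G\times X\to X$, $(g,x)\mapsto g.x$, is continuous. $C(X)$ is the algebra of complex-valued continuous functions on $X$ with pointwise operations. The skew group algebra $C(X)\rtimes_\sigma G$ is (algebraically, with no completion) the free left $C(X)$-module with basis $\{u_g\}_{g\in G}$, with multiplication the bilinear extension of $(a u_g)(b u_h) = a\,\sigma_g(b)\,u_{gh}$ for $a,b\in C(X)$, $g,h\in G$; $C(X)$ is identified with $C(X)u_e$. An ideal means a two-sided ideal (not necessarily closed). An ideal $I$ of $C(X)$ is $G$-invariant if $\sigma_g(I)\subseteq I$ for all $g\in G$; $C(X)$ is $G$-simple if $\{0\}$ and $C(X)$ are its only $G$-invariant ideals. A commutative subalgebra $S$ of $T$ is maximal commutative if it equals its centralizer in $T$. $Z(T)$ denotes the centre of $T$. A simple algebra is a nonzero algebra with no two-sided ideals other than $\{0\}$ and itself. $(X,G)$ is faithful if for each $g\in G\setminus\{e\}$ there is $x\in X$ with $g.x\neq x$. A subset $V\subseteq X$ is $G$-invariant if $g.V\subseteq V$ for all $g\in G$; $(X,G)$ is minimal if $X$ contains no non-empty proper closed $G$-invariant subset. *)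

(* Defs.v *)
From HB Require Import structures.
From mathcomp Require Import all_boot all_order all_algebra finmap.
From mathcomp Require Import all_classical all_reals all_analysis.
From mathcomp Require Import complex.

Set Implicit Arguments.
Unset Strict Implicit.
Unset Printing Implicit Defensive.

Import GRing.Theory Num.Theory.
Import numFieldNormedType.Exports.

Local Open Scope classical_set_scope.
Local Open Scope complex_scope.
Local Open Scope ring_scope.

(* The library topologizes every numFieldType by its norm; this makes that
   topology canonical on the complex numbers R[i]. *)
HB.instance Definition _ (R : rcfType) :=
  NormedModule.copy R[i] (R[i] : numClosedFieldType)^o.

HB.mixin Record isTopologicalGroup G of Topological G & Group G := {
  mulg_continuous : continuous (fun p : G * G => (p.1 * p.2)%g);
  invg_continuous : continuous (fun g : G => g^-1%g)
}.

#[short(type="topologicalGroupType")]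
HB.structure Definition TopologicalGroup :=
  {G of Topological G & Group G & isTopologicalGroup G}.

Section RingNotions.
Context (T : pzRingType).
Implicit Types I S : set T.

(* In a unital algebra over a field, the two-sided algebra ideals are exactly
   the two-sided ring ideals, since c *: x = (c *: 1) * x. *)
Definition two_sided_ideal I : Prop :=
  [/\ I 0, forall x y, I x -> I y -> I (x + y) &
      forall a x, I x -> I (a * x) /\ I (x * a)].

Definition simple_algebra : Prop :=
  (1 : T) <> 0 /\
  forall I, two_sided_ideal I -> I = [set 0] \/ I = setT.

Definition centralizer S : set T := [set x | forall s, S s -> s * x = x * s].

Definition ring_center : set T := centralizer setT.

Definition maximal_commutative S : Prop := S = centralizer S.

Definition is_field S : Prop :=
  [/\ S 1, forall x y, S x -> S y -> S (x - y) /\ S (x * y),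
      forall x y, S x -> S y -> x * y = y * x, (1 : T) <> 0 &
      forall x, S x -> x <> 0 -> exists2 y, S y & x * y = 1].

End RingNotions.

Arguments simple_algebra : clear implicits.
Arguments ring_center : clear implicits.

(* A homomorphism from G to the ring automorphisms of A; each sigma g is
   bijective, with inverse sigma g^-1. *)
Record ringAction (A : pzRingType) (G : groupType) := RingAction {
  ring_act :> G -> {rmorphism A -> A};
  ring_act1 : forall a, ring_act 1%g a = a;
  ring_actM : forall g h a, ring_act (g * h)%g a = ring_act g (ring_act h a)
}.

Definition invariant_set (A : pzRingType) (G : groupType)
    (sigma : ringAction A G) (I : set A) : Prop :=
  forall g, sigma g @` I `<=` I.

Definition G_simple (A : pzRingType) (G : groupType)
    (sigma : ringAction A G) : Prop :=
  forall I : set A, two_sided_ideal I -> invariant_set sigma I ->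
    I = [set 0] \/ I = setT.

(* The underlying type is that of finitely supported functions G -> A, where
   x : G -> A stands for the sum of the (x g) u_g. *)
Record skewGroupAlg (A : pzRingType) (G : groupType) (sigma : ringAction A G) :=
  SkewGroupAlg { skew_coef : {fsfun G -> A with 0} }.

HB.instance Definition _ A G (sigma : ringAction A G) :=
  [isNew for @skew_coef A G sigma].
HB.instance Definition _ A G (sigma : ringAction A G) :=
  [Choice of skewGroupAlg sigma by <:].

Section SkewGroupAlg.
Local Open Scope fset_scope.
Local Open Scope ring_scope.
Context (A : pzRingType) (G : groupType) (sigma : ringAction A G).
Local Notation T := (skewGroupAlg sigma).
Implicit Types (x y z : T) (a b : A) (g h k : G).

Definition coef x g : A := skew_coef x g.
Definition supp x : {fset G} := finsupp (skew_coef x).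

Lemma skewP x y : coef x =1 coef y <-> x = y.
Proof.
split=> [xy|-> //]; apply: val_inj; apply/fsfunP => g; exact: xy.
Qed.

Lemma supp_coef0 x g : g \notin supp x -> coef x g = 0.
Proof. exact: fsfun_dflt. Qed.

Lemma skew_of_subproof (E : {fset G}) (f : G -> A) :
  {x : T | forall g, coef x g = if g \in E then f g else 0}.
Proof.
exists (SkewGroupAlg sigma [fsfun g in E => f g]) => g.
by rewrite /coef /= fsfun_fun.
Qed.

Definition skew_of E f : T := sval (skew_of_subproof E f).

Lemma coef_of E f g : coef (skew_of E f) g = if g \in E then f g else 0.
Proof. exact: (svalP (skew_of_subproof E f)). Qed.

(* skew_mono a g is the element a u_g. *)
Definition skew_mono a g : T := skew_of [fset g] (fun=> a).

Lemma coef_mono a g h : coef (skew_mono a g) h = if h == g then a else 0.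
Proof. by rewrite coef_of in_fset1. Qed.

Let zero : T := skew_of fset0 (fun=> 0).
Let add x y : T := skew_of (supp x `|` supp y) (fun g => coef x g + coef y g).
Let opp x : T := skew_of (supp x) (fun g => - coef x g).

Let coef_zero g : coef zero g = 0.
Proof. by rewrite coef_of in_fset0. Qed.

Let coef_add x y g : coef (add x y) g = coef x g + coef y g.
Proof.
rewrite coef_of in_fsetU; case: ifPn => //.
by rewrite negb_or => /andP[/supp_coef0 -> /supp_coef0 ->]; rewrite addr0.
Qed.

Let coef_opp x g : coef (opp x) g = - coef x g.
Proof. by rewrite coef_of; case: ifPn => // /supp_coef0 ->; rewrite oppr0. Qed.

Let addA : associative add.
Proof. by move=> x y z; apply/skewP => g; rewrite !coef_add addrA. Qed.
Let addC : commutative add.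
Proof. by move=> x y; apply/skewP => g; rewrite !coef_add addrC. Qed.
Let add0 : left_id zero add.
Proof. by move=> x; apply/skewP => g; rewrite coef_add coef_zero add0r. Qed.
Let addN : left_inverse zero opp add.
Proof.
by move=> x; apply/skewP => g; rewrite coef_add coef_opp coef_zero addNr.
Qed.

HB.instance Definition _ := GRing.isZmodule.Build T addA addC add0 addN.

Lemma coef0 g : coef 0 g = 0. Proof. exact: coef_zero. Qed.
Lemma coefD x y g : coef (x + y) g = coef x g + coef y g.
Proof. exact: coef_add. Qed.
Lemma coefN x g : coef (- x) g = - coef x g.
Proof. exact: coef_opp. Qed.

Lemma coef_sum (I : Type) (r : seq I) (P : pred I) (F : I -> T) g :
  coef (\sum_(i <- r | P i) F i) g = \sum_(i <- r | P i) coef (F i) g.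
Proof.
elim: r => [|i r IH]; first by rewrite !big_nil coef0.
by rewrite !big_cons; case: (P i); rewrite ?coefD IH.
Qed.

Let scale a x : T := skew_of (supp x) (fun g => a * coef x g).

Let coef_scale a x g : coef (scale a x) g = a * coef x g.
Proof. by rewrite coef_of; case: ifPn => // /supp_coef0 ->; rewrite mulr0. Qed.

Let scaleA a b x : scale a (scale b x) = scale (a * b) x.
Proof. by apply/skewP => g; rewrite !coef_scale mulrA. Qed.
Let scale1 : left_id 1 scale.
Proof. by move=> x; apply/skewP => g; rewrite coef_scale mul1r. Qed.
Let scaleDr : right_distributive scale +%R.
Proof.
by move=> a x y; apply/skewP => g; rewrite !(coefD, coef_scale) mulrDr.
Qed.
Let scaleDl x : {morph scale^~ x : a b / a + b}.
Proof.
by move=> a b; apply/skewP => g; rewrite !(coefD, coef_scale) mulrDl.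
Qed.

HB.instance Definition _ :=
  GRing.Zmodule_isLmodule.Build A T scaleA scale1 scaleDr scaleDl.

Lemma coefZ a x g : coef (a *: x) g = a * coef x g.
Proof. exact: coef_scale. Qed.

Lemma skew_mono0 g : skew_mono 0 g = 0.
Proof. by apply/skewP => h; rewrite coef_mono coef0 if_same. Qed.

Lemma skew_monoD a b g : skew_mono (a + b) g = skew_mono a g + skew_mono b g.
Proof.
apply/skewP => h; rewrite coefD !coef_mono.
by case: ifP => //; rewrite addr0.
Qed.

Lemma skew_monoZ a b g : skew_mono (a * b) g = a *: skew_mono b g.
Proof.
by apply/skewP => h; rewrite coefZ !coef_mono; case: ifP; rewrite ?mulr0.
Qed.

Section Extend.
Context (V : nmodType) (F : G -> A -> V).
Hypothesis F0 : forall g, F g 0 = 0.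
Hypothesis FD : forall g, {morph F g : a b / a + b}.

Let extend x := \sum_(g <- supp x) F g (coef x g).

Lemma extendw (E : {fset G}) x : supp x `<=` E ->
  extend x = \sum_(g <- E) F g (coef x g).
Proof.
by move=> xE; apply: big_fset_incl => // g _ /supp_coef0 ->; rewrite F0.
Qed.

Lemma extendD x y : extend (x + y) = extend x + extend y.
Proof.
pose E := supp x `|` supp y `|` supp (x + y).
have xE : supp x `<=` E by rewrite /E -fsetUA fsubsetUl.
have yE : supp y `<=` E.
  by apply: (fsubset_trans (fsubsetUr (supp x) _)); rewrite fsubsetUl.
have xyE : supp (x + y) `<=` E by rewrite fsubsetUr.
rewrite (extendw xE) (extendw yE) (extendw xyE) -big_split /=.
by apply: eq_bigr => g _; rewrite coefD FD.
Qed.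

Lemma extend_mono a g : extend (skew_mono a g) = F g a.
Proof.
rewrite (@extendw [fset g]) ?big_seq_fset1 ?coef_mono ?eqxx //.
apply/fsubsetP => h; rewrite mem_finsupp => /eqP; rewrite in_fset1.
by have := coef_mono a g h; rewrite /coef => ->; case: eqP.
Qed.

Lemma extend0 : extend 0 = 0.
Proof.
rewrite (@extendw fset0) ?big_seq_fset0 //.
by apply/fsubsetP => h; rewrite mem_finsupp [skew_coef _ _]coef0 eqxx.
Qed.

End Extend.

Lemma skewE x : x = \sum_(g <- supp x) skew_mono (coef x g) g.
Proof.
apply/skewP => h; rewrite coef_sum.
under eq_bigr => g _ do rewrite coef_mono eq_sym.
have [hx|hx] := boolP (h \in supp x).
  rewrite (big_fsetD1 h) //= eqxx big1_seq ?addr0 // => g /andP[_].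
  by rewrite in_fsetD1 => /andP[/negbTE ->].
rewrite supp_coef0 // big1_seq // => g /andP[_ gx].
by case: eqP => // gh; rewrite -gh gx in hx.
Qed.

(* The bilinear extension of (a u_g) (b u_h) = a sigma_g(b) u_(gh). *)
Definition skew_mul x y : T :=
  \sum_(g <- supp x) \sum_(h <- supp y)
    skew_mono (coef x g * sigma g (coef y h)) (g * h)%g.

Let mulDl : left_distributive skew_mul +%R.
Proof.
move=> x y z; rewrite /skew_mul.
pose F g a := \sum_(h <- supp z) skew_mono (a * sigma g (coef z h)) (g * h)%g.
apply: (@extendD _ F) => g => [|a b]; rewrite /F.
  by rewrite big1 // => h _; rewrite mul0r skew_mono0.
by rewrite -big_split; apply: eq_bigr => h _; rewrite mulrDl skew_monoD.
Qed.

Let mulDr : right_distributive skew_mul +%R.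
Proof.
move=> x y z; rewrite /skew_mul -big_split; apply: eq_bigr => g _ /=.
pose F h b := skew_mono (coef x g * sigma g b) (g * h)%g.
apply: (@extendD _ F) => h => [|a b]; rewrite /F.
  by rewrite rmorph0 mulr0 skew_mono0.
by rewrite rmorphD mulrDr skew_monoD.
Qed.

Let mul_mono a b g h : skew_mul (skew_mono a g) (skew_mono b h) =
  skew_mono (a * sigma g b) (g * h)%g.
Proof.
rewrite /skew_mul.
pose F g a := \sum_(k <- supp (skew_mono b h))
  skew_mono (a * sigma g (coef (skew_mono b h) k)) (g * k)%g.
rewrite (@extend_mono _ F) => [|k]; last first.
  by rewrite /F big1 // => l _; rewrite mul0r skew_mono0.
rewrite /F.
pose F' k b := skew_mono (a * sigma g b) (g * k)%g.
by rewrite (@extend_mono _ F') // => k; rewrite /F' rmorph0 mulr0 skew_mono0.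
Qed.

Let mul0x x : skew_mul 0 x = 0.
Proof. by apply: (addrI (skew_mul 0 x)); rewrite -mulDl !addr0. Qed.

Let mulx0 x : skew_mul x 0 = 0.
Proof. by apply: (addrI (skew_mul x 0)); rewrite -mulDr !addr0. Qed.

Let mul_suml (I : Type) (r : seq I) (F : I -> T) y :
  skew_mul (\sum_(i <- r) F i) y = \sum_(i <- r) skew_mul (F i) y.
Proof. by apply: (big_morph (skew_mul^~ y)). Qed.

Let mul_sumr (I : Type) (r : seq I) (F : I -> T) y :
  skew_mul y (\sum_(i <- r) F i) = \sum_(i <- r) skew_mul y (F i).
Proof. by apply: (big_morph (skew_mul y)). Qed.

Let mulA : associative skew_mul.
Proof.
move=> x y z; rewrite (skewE x) !mul_suml; apply: eq_bigr => g _.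
rewrite (skewE y) mul_suml !mul_sumr mul_suml; apply: eq_bigr => h _.
rewrite (skewE z) !mul_sumr; apply: eq_bigr => k _.
by rewrite !mul_mono rmorphM ring_actM mulrA mulgA.
Qed.

Let mul1 : left_id (skew_mono 1 1%g) skew_mul.
Proof.
move=> x; rewrite [in RHS](skewE x) (skewE x) mul_sumr -skewE.
by apply: eq_bigr => g _; rewrite mul_mono mul1r mul1g ring_act1.
Qed.

Let mulx1 : right_id (skew_mono 1 1%g) skew_mul.
Proof.
move=> x; rewrite [in RHS](skewE x) (skewE x) mul_suml -skewE.
by apply: eq_bigr => g _; rewrite mul_mono rmorph1 mulr1 mulg1.
Qed.

HB.instance Definition _ :=
  GRing.Zmodule_isPzRing.Build T mulA mul1 mulx1 mulDl mulDr.

Lemma skew_monoM a b g h :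
  skew_mono a g * skew_mono b h = skew_mono (a * sigma g b) (g * h)%g.
Proof. exact: mul_mono. Qed.

Lemma skew_mono1 : skew_mono 1 1%g = 1.
Proof. by []. Qed.

(* The copy A u_e of A. *)
Definition base_subring : set T := range (skew_mono^~ 1%g).

End SkewGroupAlg.

Arguments base_subring {A G} sigma.

Definition contC (R : realType) (X : topologicalType) := continuousType X R[i].

HB.instance Definition _ R X := Choice.on (contC R X).

Section ContC.
Context (R : realType) (X : topologicalType).
Local Notation CX := (contC R X).
Implicit Types f g : CX.

Definition contC_fun f : X -> R[i] := f.

Lemma contCP f g : contC_fun f =1 contC_fun g <-> f = g.
Proof. by split=> [fg|-> //]; apply/continuousEP. Qed.

Lemma contC_continuous f : continuous (contC_fun f).
Proof. exact: cts_fun. Qed.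

Definition mk_contC (f : X -> R[i]) (cf : continuous f) : CX := mkcts cf.

Let cst_continuous (c : R[i]) : continuous (fun _ : X => c).
Proof. by move=> x; exact: cvg_cst. Qed.
Let add_continuous f g : continuous (contC_fun f \+ contC_fun g).
Proof. by move=> x; apply: cvgD; exact: contC_continuous. Qed.
Let opp_continuous f : continuous (\- contC_fun f).
Proof. by move=> x; apply: cvgN; exact: contC_continuous. Qed.
Let mul_continuous f g : continuous (contC_fun f \* contC_fun g).
Proof. by move=> x; apply: cvgM; exact: contC_continuous. Qed.

Let zero : CX := mk_contC (@cst_continuous 0).
Let one : CX := mk_contC (@cst_continuous 1).
Let add f g : CX := mk_contC (@add_continuous f g).
Let opp f : CX := mk_contC (@opp_continuous f).
Let mul f g : CX := mk_contC (@mul_continuous f g).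

Let addA : associative add.
Proof. by move=> f g h; apply/contCP => x; exact: addrA. Qed.
Let addC : commutative add.
Proof. by move=> f g; apply/contCP => x; exact: addrC. Qed.
Let add0 : left_id zero add.
Proof. by move=> f; apply/contCP => x; exact: add0r. Qed.
Let addN : left_inverse zero opp add.
Proof. by move=> f; apply/contCP => x; exact: addNr. Qed.

HB.instance Definition _ := GRing.isZmodule.Build CX addA addC add0 addN.

Let mulA : associative mul.
Proof. by move=> f g h; apply/contCP => x; exact: mulrA. Qed.
Let mulC : commutative mul.
Proof. by move=> f g; apply/contCP => x; exact: mulrC. Qed.
Let mul1 : left_id one mul.
Proof. by move=> f; apply/contCP => x; exact: mul1r. Qed.
Let mulD : left_distributive mul +%R.
Proof. by move=> f g h; apply/contCP => x; exact: mulrDl. Qed.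

Let mulx1 : right_id one mul.
Proof. by move=> f; rewrite mulC mul1. Qed.
Let mulDr : right_distributive mul +%R.
Proof. by move=> f g h; rewrite mulC mulD !(mulC f). Qed.

HB.instance Definition _ :=
  GRing.Zmodule_isPzRing.Build CX mulA mul1 mulx1 mulD mulDr.
HB.instance Definition _ := GRing.PzRing_hasCommutativeMul.Build CX mulC.

Lemma contC0E x : contC_fun 0 x = 0. Proof. by []. Qed.
Lemma contC1E x : contC_fun 1 x = 1. Proof. by []. Qed.
Lemma contCDE f g x : contC_fun (f + g) x = contC_fun f x + contC_fun g x.
Proof. by []. Qed.
Lemma contCNE f x : contC_fun (- f) x = - contC_fun f x.
Proof. by []. Qed.
Lemma contCME f g x : contC_fun (f * g) x = contC_fun f x * contC_fun g x.
Proof. by []. Qed.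

End ContC.

Record transformationGroup := TransformationGroup {
  tg_space : topologicalType;
  tg_group : topologicalGroupType;
  tg_compact : compact [set: tg_space];
  tg_hausdorff : hausdorff_space tg_space;
  tg_act : tg_group -> tg_space -> tg_space;
  tg_act1 : forall x, tg_act 1%g x = x;
  tg_actM : forall g h x, tg_act (g * h)%g x = tg_act g (tg_act h x);
  tg_act_continuous :
    continuous (fun p : tg_group * tg_space => tg_act p.1 p.2)
}.

Section TransformationGroup.
Context (XG : transformationGroup).
Local Notation X := (tg_space XG).
Local Notation G := (tg_group XG).

Definition tg_faithful : Prop :=
  forall g : G, g <> 1%g -> exists x : X, tg_act g x <> x.

Definition invariant_subset (V : set X) : Prop :=
  forall g : G, tg_act g @` V `<=` V.

Definition tg_minimal : Prop :=
  forall V : set X, V !=set0 -> closed V -> invariant_subset V -> V = setT.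

Context (R : realType).
Local Notation CX := (contC R X).

Lemma tg_act_continuousr (g : G) : continuous (@tg_act XG g).
Proof.
move=> x; have /= := @continuous_comp X (G * X)%type X (fun y => (g, y))
  (fun p => tg_act p.1 p.2) x.
apply; last exact: tg_act_continuous.
by apply: cvg_pair => //; exact: cvg_cst.
Qed.

Lemma tg_sigma_subproof (g : G) (f : CX) :
  continuous (fun x : X => contC_fun f (tg_act g^-1%g x)).
Proof.
move=> x; apply: (@continuous_comp _ _ _ (tg_act g^-1%g) (contC_fun f)).
  exact: tg_act_continuousr.
exact: contC_continuous.
Qed.

Definition tg_sigma_fun (g : G) (f : CX) : CX :=
  mk_contC (@tg_sigma_subproof g f).

Lemma tg_sigma_funE g f x :
  contC_fun (tg_sigma_fun g f) x = contC_fun f (tg_act g^-1%g x).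
Proof. by []. Qed.

Let sigmaB g : zmod_morphism (tg_sigma_fun g).
Proof. by move=> f f'; apply/contCP. Qed.
Let sigmaM g : monoid_morphism (tg_sigma_fun g).
Proof. by split=> [|f f']; apply/contCP. Qed.

HB.instance Definition _ g :=
  GRing.isZmodMorphism.Build CX CX (tg_sigma_fun g) (sigmaB g).
HB.instance Definition _ g :=
  GRing.isMonoidMorphism.Build CX CX (tg_sigma_fun g) (sigmaM g).

Let sigma1 f : tg_sigma_fun 1%g f = f.
Proof. by apply/contCP => x; rewrite tg_sigma_funE invg1 tg_act1. Qed.
Let sigma_mul g h f :
  tg_sigma_fun (g * h)%g f = tg_sigma_fun g (tg_sigma_fun h f).
Proof. by apply/contCP => x; rewrite !tg_sigma_funE invgM tg_actM. Qed.

Definition tg_sigma : ringAction CX G :=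
  @RingAction CX G (fun g => tg_sigma_fun g) sigma1 sigma_mul.

Definition tg_sigma_injective : Prop :=
  forall g h : G, tg_sigma g =1 tg_sigma h -> g = h.

End TransformationGroup.

(* Main.v *)
Require Import Defs.
From HB Require Import structures.
From mathcomp Require Import all_boot all_order all_algebra finmap.
From mathcomp Require Import all_classical all_reals all_analysis.
From mathcomp Require Import complex.
(* coefD, coefN and the like are to denote the coefficients of the skew group
   algebra, not those of polynomials. *)
Import Defs.

(** Write A for C(X), T for the skew group algebra, and u_g for its basis; the
    element a u_g is skew_mono a g.

    Comparing coefficients, x centralizes A exactly when each coefficient r of
    x, say at u_g, satisfies a r = r sigma_g(a) for all a.  Hence A is maximal
    commutative if and only if no nonzero r satisfies this for some g other
    than e (maximal_commutativeP).  This reduces (i) <-> (ii) to two purely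
    algebraic arguments, valid for every nonzero commutative coefficient ring
    (simpleP).  If r is such a nonzero element, the ideal generated by
    r u_e - r u_g is killed by the augmentation sending each u_g to 1, so that
    T is not simple.  Conversely, if A is maximal commutative, a nonzero
    element of an ideal I with least support, moved so that its support
    contains e, must commute with A, for its commutators with A lie in I and
    have smaller support; so it lies in A, and the trace of I on A is a nonzero
    invariant ideal.

    As soon as A is G-simple and the centre of T is contained in A, the centre
    is a field (center_field): a central r is invariant, so rA is an invariant
    ideal.  This gives (i) -> (iii), and also (iii) for the example in (c).

    The equivalence of (iv) and (v) is the duality between closed invariant
    subsets of X and invariant ideals of C(X): every proper ideal has a common
    zero by compactness (proper_ideal_common_zero), and closed sets are cut out
    by continuous functions by the Urysohn lemma (contC_separates).

    For abelian G, two observations close the circle.  If sigma_g is the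
    identity then u_g is central, and 1 - u_g is not invertible because the
    augmentation kills its multiples; so g = e when the centre is a field.  And for fixed
    g the elements r with a r = r sigma_g(a) for all a form an invariant ideal,
    which by G-simplicity is 0 unless sigma_g is the identity.

    For (c), take the group of all homeomorphisms of the Cantor space, made
    discrete.  It is transitive, hence minimal, and it is faithful.  A central
    element has a support closed under conjugation, and every homeomorphism
    other than the identity has infinitely many conjugates
    (homeo_cantor_infinite_conjugacy), so the centre lies in C(X).  But some
    homeomorphism other than the identity fixes a nonempty clopen set
    pointwise, and the indicator function r of that set violates maximal
    commutativity. *)

Set Implicit Arguments.
Unset Strict Implicit.
Unset Printing Implicit Defensive.

Import Order.TTheory GRing.Theory Num.Theory.
Import numFieldNormedType.Exports.

Local Open Scope fset_scope.
Local Open Scope classical_set_scope.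
Local Open Scope ring_scope.

(** * Coefficients and augmentation in a skew group algebra *)

Section SkewGroupAlgebra.
Context (A : pzRingType) (G : groupType) (sigma : ringAction A G).
Local Notation T := (skewGroupAlg sigma).
Local Notation mono := (@skew_mono A G sigma).
Implicit Types (x y z : T) (a b r : A) (g h s : G).

Lemma skew_ind (P : T -> Prop) :
  (forall x y, P x -> P y -> P (x + y)) -> (forall a g, P (mono a g)) ->
  forall x, P x.
Proof.
move=> PD Pm x; rewrite (skewE x); apply: big_ind => //.
by rewrite -(skew_mono0 sigma 1%g).
Qed.

Lemma skew_monoN a g : mono (- a) g = - mono a g.
Proof.
by apply/eqP; rewrite -addr_eq0 -skew_monoD addNr skew_mono0.
Qed.

Lemma coef_mono_mul a s x g :
  coef (mono a s * x) g = a * sigma s (coef x (s^-1 * g)%g).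
Proof.
elim/skew_ind: x => [x y IHx IHy|b h].
  by rewrite mulrDr !coefD IHx IHy rmorphD mulrDr.
rewrite skew_monoM !coef_mono.
have -> : (g == (s * h)%g) = ((s^-1 * g)%g == h).
  by apply/eqP/eqP => [->|<-]; rewrite ?mulKg ?mulVKg.
by case: eqP => // _; rewrite rmorph0 mulr0.
Qed.

Lemma coef_mul_mono x b t g :
  coef (x * mono b t) g = coef x (g * t^-1)%g * sigma (g * t^-1)%g b.
Proof.
elim/skew_ind: x => [x y IHx IHy|a h].
  by rewrite mulrDl !coefD IHx IHy mulrDl.
rewrite skew_monoM !coef_mono.
have -> : (g == (h * t)%g) = ((g * t^-1)%g == h).
  by apply/eqP/eqP => [->|<-]; rewrite ?mulgK ?mulgVK.
by case: eqP => [->|] //; rewrite mul0r.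
Qed.

Lemma coef_base_mul a x g : coef (mono a 1%g * x) g = a * coef x g.
Proof. by rewrite coef_mono_mul invg1 mul1g ring_act1. Qed.

Lemma coef_mul_base x a g : coef (x * mono a 1%g) g = coef x g * sigma g a.
Proof. by rewrite coef_mul_mono invg1 mulg1. Qed.

Lemma base_mono x : (forall g, g <> 1%g -> coef x g = 0) ->
  x = mono (coef x 1%g) 1%g.
Proof.
by move=> x0; apply/skewP => g; rewrite coef_mono; case: eqP => [->|/x0].
Qed.

Lemma centralizer_baseP x : centralizer (base_subring sigma) x <->
  forall g a, a * coef x g = coef x g * sigma g a.
Proof.
split=> [cx g a|cx _ [a _ <-]].
  by rewrite -coef_base_mul -coef_mul_base cx //; exists a.
by apply/skewP => g; rewrite coef_base_mul coef_mul_base.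
Qed.

(** Additive, but a ring morphism only when the action is trivial. *)
Definition augmentation x : A := \sum_(g <- supp x) coef x g.
Local Notation aug := augmentation.

Lemma augmentationD x y : aug (x + y) = aug x + aug y.
Proof. exact: (@extendD A G sigma A (fun _ a => a)). Qed.

Lemma augmentation_mono a g : aug (mono a g) = a.
Proof. exact: (@extend_mono A G sigma A (fun _ a => a)). Qed.

Lemma augmentation0 : aug 0 = 0.
Proof. by rewrite -(skew_mono0 sigma 1%g) augmentation_mono. Qed.

Lemma augmentationB x y : aug (x - y) = aug x - aug y.
Proof. by apply/(canRL (addrK _)); rewrite -augmentationD subrK. Qed.

Lemma augmentation_unit_mul x g : aug (x * mono 1 g) = aug x.
Proof.
elim/skew_ind: x => [x y IHx IHy|a h].
  by rewrite mulrDl !augmentationD IHx IHy.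
by rewrite skew_monoM rmorph1 mulr1 !augmentation_mono.
Qed.

Lemma ideal_mulr (I : set T) x y : two_sided_ideal I -> I x -> I (x * y).
Proof. by case=> _ _ /[apply] /(_ y)[]. Qed.

(** The elements whose coefficients all lie in an invariant ideal J form an
    ideal that meets A in J. *)
Lemma simple_G_simple : simple_algebra T -> G_simple sigma.
Proof.
move=> [_ simT] J [J0 JD JM] Jinv.
pose I := [set x : T | forall g, J (coef x g)].
have [|IE|IE] := simT I.
- split=> [g|x y Ix Iy g|y x Ix]; first by rewrite coef0.
    by rewrite coefD; exact: JD.
  split; elim/skew_ind: y => [y z Iy Iz|a s] g.
  + by rewrite mulrDl coefD; exact: JD.
  + rewrite coef_mono_mul; apply: (JM _ _ _).1; apply: (Jinv s).
    by exists (coef x (s^-1 * g)%g).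
  + by rewrite mulrDr coefD; exact: JD.
  + by rewrite coef_mul_mono; apply: (JM _ _ _).2.
- left; apply/seteqP; split=> [a Ja|_ ->] //.
  have : I (mono a 1%g) by move=> g; rewrite coef_mono; case: ifP.
  rewrite IE => /(congr1 (fun x => coef x 1%g)).
  by rewrite coef_mono eqxx coef0.
- right; apply/seteqP; split=> [//|a _].
  have : I (mono a 1%g) by rewrite IE.
  by move=> /(_ 1%g); rewrite coef_mono eqxx.
Qed.

Lemma skew_neq0 : (1 : A) <> 0 -> (1 : T) <> 0.
Proof.
by move=> A1 /(congr1 aug); rewrite -skew_mono1 augmentation_mono augmentation0.
Qed.

End SkewGroupAlgebra.

(** * Simplicity, maximal commutativity and the centre *)

Section Commutative.
Context (A : comPzRingType) (G : groupType) (sigma : ringAction A G).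
Hypothesis A1 : (1 : A) <> 0.
Local Notation T := (skewGroupAlg sigma).
Local Notation mono := (@skew_mono A G sigma).
Implicit Types (x y z : T) (a b r : A) (g h s : G).

(** Only the coefficients off the neutral element obstruct maximal
    commutativity, since A is commutative; and they can be tested one at a
    time, because the commutation relations do not mix them. *)
Lemma maximal_commutativeP : maximal_commutative (base_subring sigma) <->
  forall g r, g <> 1%g -> (forall a, a * r = r * sigma g a) -> r = 0.
Proof.
split=> [mc g r g1 rg|noinv].
  have : centralizer (base_subring sigma) (mono r g).
    apply/centralizer_baseP => h a; rewrite coef_mono.
    by case: eqP => [->//|_]; rewrite mulr0 mul0r.
  rewrite -mc => -[b _] /(congr1 (fun x => coef x g)).
  by rewrite !coef_mono eqxx; case: eqP.
apply/seteqP; split=> [_ [b _ <-]|x cx].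
  apply/centralizer_baseP => h a; rewrite coef_mono.
  by case: eqP => [->|_]; rewrite ?mulr0 ?mul0r // ring_act1 mulrC.
exists (coef x 1%g) => //; rewrite -base_mono // => g g1.
by apply: (noinv g) => // a; apply: (centralizer_baseP _).1.
Qed.

(** A coefficient r violating maximal commutativity at g yields the element
    r u_e - r u_g of the largest ideal on which the augmentation vanishes:
    b u_s (r u_e - r u_g) c u_t is the difference of two monomials with equal
    coefficients. *)
Lemma simple_maximal_commutative : simple_algebra T ->
  maximal_commutative (base_subring sigma).
Proof.
move=> [_ simT]; apply/maximal_commutativeP => g r g1 rg.
(* the largest ideal contained in the kernel of the augmentation *)
pose I := [set z : T | forall p q, augmentation (p * z * q) = 0].
have Iid : two_sided_ideal I.
  split=> [p q|x y Ix Iy p q|y x Ix].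
  - by rewrite mulr0 mul0r augmentation0.
  - by rewrite mulrDr mulrDl augmentationD Ix Iy addr0.
  - split=> p q; first by rewrite mulrA; exact: Ix.
    by rewrite mulrA -mulrA; exact: Ix.
have Iz : I (mono r 1%g - mono r g).
  elim/skew_ind => [p p' IHp IHp'|b s] q.
    by rewrite !mulrDl augmentationD IHp IHp' addr0.
  elim/skew_ind: q => [q q' IHq IHq'|c t].
    by rewrite mulrDr augmentationD IHq IHq' addr0.
  (* r sigma_g(c) = r c, so both monomials have the same coefficient *)
  rewrite mulrBr mulrBl augmentationB !skew_monoM !augmentation_mono mulg1.
  by rewrite ring_actM -!mulrA -!rmorphM -rg (mulrC r) subrr.
have [I0|IT] := simT I Iid.
  move: Iz; rewrite I0 => /(congr1 (fun x => coef x 1%g)).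
  rewrite coefD coefN !coef_mono coef0 eqxx.
  by case: eqP => [/esym//|_]; rewrite subr0.
have : I 1 by rewrite IT.
by move=> /(_ 1 1); rewrite !mul1r -skew_mono1 augmentation_mono.
Qed.

Lemma card_supp_mul_unit x g : (#|` supp (x * mono 1 g)%R | <= #|` supp x |)%N.
Proof.
have sub : (supp (x * mono 1 g)%R `<=` [fset (h * g)%g | h in supp x])%fset.
  apply/fsubsetP => h.
  rewrite mem_finsupp => /eqP; rewrite -/(coef _ _) coef_mul_mono rmorph1 mulr1.
  move=> xh; apply/imfsetP; exists (h * g^-1)%g; last by rewrite mulgVK.
  by rewrite /= mem_finsupp; apply/eqP.
exact: leq_trans (fsubset_leq_card sub) (leq_imfset_card _ _ _).
Qed.

(** Minimality of the support makes the chosen element commute with A: its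
    commutator with a is again in I and loses the coefficient at e. *)
Lemma ideal_meets_base (I : set T) : two_sided_ideal I -> I <> [set 0] ->
  maximal_commutative (base_subring sigma) ->
  exists2 b, b <> 0 & I (mono b 1%g).
Proof.
move=> Iid I0 mc; have [I00 ID IM] := Iid.
have Inz : exists n, `[< exists x, [/\ I x, x <> 0 & #|` supp x | = n] >].
  have [x [Ix x0]] : exists x, I x /\ x <> 0.
    apply: contrapT => nx; apply: I0; apply/seteqP; split=> [x Ix|_ -> //].
    by apply: contrapT => x0; apply: nx; exists x.
  by exists #|` supp x |; apply/asboolP; exists x.
case: (ex_minnP Inz) => n /asboolP[x [Ix x0 xn]] nmin.
have [g xg] : exists g, coef x g <> 0.
  apply: contrapT => nx; apply: x0; apply/skewP => g; rewrite coef0.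
  by apply: contrapT => xg; apply: nx; exists g.
(* the translate of x whose support contains the neutral element *)
pose y := x * mono 1 g^-1%g.
have Iy : I y by exact: ideal_mulr.
have y1 : coef y 1%g <> 0 by rewrite coef_mul_mono invgK mul1g rmorph1 mulr1.
have cy : centralizer (base_subring sigma) y.
  move=> _ [a _ <-]; apply: contrapT => ay.
  pose w := mono a 1%g * y - y * mono a 1%g.
  have w0 : w <> 0 by move/subr0_eq.
  have Iw : I w.
    rewrite /w -mulrN -skew_monoN.
    by apply: ID; [exact: (IM _ _ Iy).1|exact: (IM _ _ Iy).2].
  have wE h : coef w h = a * coef y h - coef y h * sigma h a.
    by rewrite coefD coefN coef_base_mul coef_mul_base.
  have : (#|` supp w | < n)%N.
    rewrite -xn; apply: leq_trans (card_supp_mul_unit x g^-1%g).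
    apply: fproper_ltn_card; rewrite fproperE; apply/andP; split.
      apply/fsubsetP => h; rewrite !mem_finsupp -!/(coef _ _) wE.
      by apply: contraNN => /eqP ->; rewrite mulr0 mul0r subrr.
    apply/negP => /fsubsetP /(_ 1%g).
    rewrite !mem_finsupp -!/(coef _ _) wE ring_act1 mulrC subrr eqxx.
    by move/eqP: y1 => y1 /(_ y1).
  rewrite ltnNge => /negP; apply; apply: nmin.
  by apply/asboolP; exists w.
move: cy; rewrite -mc => -[b _ by_]; exists b; last by rewrite by_.
by move=> b0; apply: y1; rewrite -by_ coef_mono eqxx.
Qed.

Lemma G_simple_maximal_commutative_simple : G_simple sigma ->
  maximal_commutative (base_subring sigma) -> simple_algebra T.
Proof.
move=> Gsim mc; split=> [|I Iid]; first exact: skew_neq0.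
have [->|I0] := EM (I = [set 0]); [by left|right].
have [b b0 Ib] := ideal_meets_base Iid I0 mc.
have [I00 ID IM] := Iid.
pose J := [set a | I (mono a 1%g)].
have Jid : two_sided_ideal J.
  split=> [|a c Ja Jc|c a Ja]; rewrite /J/= ?skew_mono0 ?skew_monoD //.
    exact: ID.
  have monoM p q : mono (p * q) 1%g = mono p 1%g * mono q 1%g.
    by rewrite skew_monoM mulg1 ring_act1.
  by rewrite !monoM; split; [exact: (IM _ _ Ja).1|exact: (IM _ _ Ja).2].
have Jinv : invariant_set sigma J.
  move=> g _ [a Ja <-]; rewrite /J/=.
  have -> : mono (sigma g a) 1%g = mono 1 g * mono a 1%g * mono 1 g^-1%g.
    by rewrite !skew_monoM mul1r rmorph1 mulr1 mulg1 mulgV.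
  by apply: (IM _ _ _).2; apply: (IM _ _ _).1.
have [JE|JT] := Gsim J Jid Jinv.
  by case: b0; have : J b by []; rewrite JE.
have I1 : I 1 by have : J 1 by rewrite JT.
by apply/seteqP; split=> // x _; rewrite -[x]mul1r; exact: ideal_mulr.
Qed.

Lemma simpleP : simple_algebra T <->
  G_simple sigma /\ maximal_commutative (base_subring sigma).
Proof.
split=> [simT|[Gsim mc]]; last exact: G_simple_maximal_commutative_simple.
by split; [exact: simple_G_simple|exact: simple_maximal_commutative].
Qed.

Lemma maximal_commutative_center_base :
  maximal_commutative (base_subring sigma) ->
  ring_center T `<=` base_subring sigma.
Proof. by move=> -> x cx s _; exact: cx. Qed.

(** A central r in A is fixed by every sigma_g, so rA is an invariant ideal
    and r is invertible unless it is 0; the inverse of a central element is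
    central. *)
Lemma center_field : G_simple sigma -> ring_center T `<=` base_subring sigma ->
  is_field (ring_center T).
Proof.
move=> Gsim cb; split; last 2 first.
- exact: skew_neq0.
- move=> x cx x0; have [r _ rx] := cb x cx.
  have rinv g : sigma g r = r.
    have : mono 1 g * mono r 1%g = mono r 1%g * mono 1 g.
      by rewrite rx; exact: cx.
    rewrite !skew_monoM rmorph1 mulr1 mul1r mulg1 mul1g.
    by move=> /(congr1 (fun x => coef x g)); rewrite !coef_mono eqxx.
  have [|g _ [_ [a ->] <-]|rA0|rAT] := Gsim [set b | exists a, b = r * a].
  + split=> [|_ _ [a ->] [b ->]|c _ [a ->]]; first by exists 0; rewrite mulr0.
      by exists (a + b); rewrite mulrDr.
    split; exists (a * c); last by rewrite mulrA.
    by rewrite mulrC mulrA.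
  + by exists (sigma g a); rewrite rmorphM rinv.
  + case: x0; rewrite -rx.
    suff -> : r = 0 by rewrite skew_mono0.
    have : [set b | exists a, b = r * a] r by exists 1; rewrite mulr1.
    by rewrite rA0.
  + have [a ra] : [set b | exists a, b = r * a] 1 by rewrite rAT.
    have xy : x * mono a 1%g = 1.
      by rewrite -rx skew_monoM ring_act1 mulg1 -ra.
    exists (mono a 1%g) => // z _; set y := mono a 1%g in xy *.
    have yx : y * x = 1 by rewrite cx.
    by rewrite -[z * y]mul1r -yx -!mulrA (mulrA x) -cx // -(mulrA z) xy mulr1.
- by move=> z _; rewrite mulr1 mul1r.
- move=> x y cx cy; split=> z _.
    by rewrite mulrBr mulrBl cx // cy.
  by rewrite mulrA cx // -mulrA cy // mulrA.
- by move=> x y cx cy; apply: cy.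
Qed.

Lemma maximal_commutative_faithful g :
  maximal_commutative (base_subring sigma) ->
  (forall a, sigma g a = a) -> g = 1%g.
Proof.
move=> /maximal_commutativeP mc ga; apply: contrapT => g1; apply: A1.
by apply: (mc g) => // a; rewrite mulr1 mul1r ga.
Qed.

(** The support of a central element is finite and stable under conjugation,
    so it contains no element with infinitely many conjugates. *)
Lemma infinite_conjugacy_center_base :
  (forall g, g <> 1%g ->
    exists s : nat -> G, injective (fun n => s n * g * (s n)^-1)%g) ->
  ring_center T `<=` base_subring sigma.
Proof.
move=> icc x cx; exists (coef x 1%g) => //; rewrite -base_mono // => g g1.
apply: contrapT => xg.
have conj_coef s : coef x (s * g * s^-1)%g = sigma s (coef x g).
  have := congr1 (fun y => coef y (s * g)%g) (cx (mono 1 s) I).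
  by rewrite coef_mono_mul coef_mul_mono mul1r mulKg rmorph1 mulr1 => <-.
have [s s_inj] := icc g g1.
pose m := #|` supp x|.
have : (size [seq (s n * g * (s n)^-1)%g | n <- iota 0 m.+1] <= m)%N.
  apply: uniq_leq_size; first by rewrite map_inj_uniq // iota_uniq.
  move=> _ /mapP[n _ ->]; rewrite mem_finsupp -/(coef _ _) conj_coef.
  apply/eqP => sxg; apply: xg.
  by rewrite -[LHS](ring_act1 sigma) -(mulVg (s n)) ring_actM sxg rmorph0.
by rewrite size_map size_iota ltnn.
Qed.

Section Abelian.
Hypothesis Gcomm : forall g h : G, (g * h = h * g)%g.

(** If sigma_g is the identity then u_g is central, and 1 - u_g is not
    invertible because the augmentation kills its multiples. *)
Lemma abelian_center_field_faithful g : is_field (ring_center T) ->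
  (forall a, sigma g a = a) -> g = 1%g.
Proof.
move=> [C1 CB _ _ CV] ga; apply: contrapT => g1.
have Cg : ring_center T (mono 1 g).
  move=> y _; elim/skew_ind: y => [y z IHy IHz|a h].
    by rewrite mulrDl mulrDr IHy IHz.
  by rewrite !skew_monoM rmorph1 mulr1 mul1r ga Gcomm.
have [|y Cy] := CV (1 - mono 1 g) (CB _ _ C1 Cg).1.
  move=> /(congr1 (fun x => coef x 1%g)).
  rewrite coefD coefN -skew_mono1 !coef_mono coef0 eqxx.
  by case: eqP => [/esym//|_]; rewrite subr0.
move=> /(congr1 (@augmentation _ _ _)).
rewrite mulrBl mul1r -Cg // augmentationB augmentation_unit_mul subrr.
by rewrite -skew_mono1 augmentation_mono => /esym.
Qed.

(** For fixed g, the r with a r = r sigma_g(a) for all a form an ideal; it is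
    invariant because sigma_g commutes with every sigma_s.  If it is all of A,
    then r = 1 shows that sigma_g is the identity. *)
Lemma abelian_maximal_commutative : G_simple sigma ->
  (forall g, (forall a, sigma g a = a) -> g = 1%g) ->
  maximal_commutative (base_subring sigma).
Proof.
move=> Gsim inj; apply/maximal_commutativeP => g r g1 rg.
pose J := [set b | forall a, a * b = b * sigma g a].
have [||J0|JT] := Gsim J.
- split=> [a|b c Jb Jc a|c b Jb]; first by rewrite mulr0 mul0r.
    by rewrite mulrDr mulrDl Jb Jc.
  by split=> a; [rewrite mulrCA Jb mulrA|rewrite mulrA Jb mulrAC].
- move=> s _ [b Jb <-] a.
  have -> : a = sigma s (sigma s^-1%g a) by rewrite -ring_actM mulgV ring_act1.
  by rewrite -rmorphM Jb rmorphM -!ring_actM !mulgA (Gcomm g s).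
- by have : J r by []; rewrite J0.
- case: g1; apply: inj => a; have : J 1 by rewrite JT.
  by move=> /(_ a); rewrite mulr1 mul1r.
Qed.

End Abelian.
End Commutative.

(** * Ideals of continuous functions and zero sets *)

Lemma real_complex_continuous (R : realType) :
  continuous (fun r : R => (r%:C)%C : R[i]).
Proof.
move=> r; apply/cvgrPdist_lt => e e0.
have eE : e = ((complex.Re e)%:C)%C.
  by case: e e0 => a b /=; rewrite ltcE /= => /andP[/eqP-> _].
have Re0 : 0 < complex.Re e by move: e0; rewrite ltcE => /andP[].
near=> t; rewrite -rmorphB normc_def /= expr0n addr0 sqrtr_sqr.
rewrite eE ltcR; near: t; exact: cvgr_dist_lt.
Unshelve. all: by end_near. Qed.

Lemma conjc_continuous (R : realType) : continuous (fun z : R[i] => conjc z).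
Proof.
move=> z; apply/cvgrPdist_lt; first exact: (@nbhs_filter R[i] z).
by move=> e e0; exists e => //= t; rewrite -rmorphB normcJ.
Qed.

Section ContinuousFunctions.
Context (R : realType) (X : topologicalType).
Local Notation CX := (contC R X).

Definition zero_set (f : CX) : set X := [set x | contC_fun f x = 0].

Lemma closed_zero_set (f : CX) : closed (zero_set f).
Proof.
apply: (@closed_comp _ _ (contC_fun f) [set 0]).
  by move=> x _; exact: contC_continuous.
apply: accessible_closed_set1; apply: hausdorff_accessible.
exact: norm_hausdorff.
Qed.

Lemma contC_unit (f : CX) : zero_set f = set0 -> exists g, g * f = 1.
Proof.
move=> f0.
have fx0 x : contC_fun f x != 0.
  by apply/eqP => fx; have : zero_set f x by []; rewrite f0.
have cg : continuous (fun x => (contC_fun f x)^-1 : R[i]).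
  by move=> x; apply: cvgV => //; exact: contC_continuous.
exists (mk_contC cg); apply/contCP => x.
by rewrite contCME /= mulVf.
Qed.

(** In a proper ideal no function is invertible, so every zero set is
    nonempty; the zero sets of f and g intersect in that of
    f^* f + g^* g, so they form a filter base, and compactness provides a
    cluster point, which lies in each of these closed sets. *)
Lemma proper_ideal_common_zero (J : set CX) : compact [set: X] ->
  two_sided_ideal J -> ~ J 1 -> exists x, forall f, J f -> contC_fun f x = 0.
Proof.
move=> cX [J0 JD JM] J1.
pose F := filter_from J zero_set.
have ZF f : J f -> zero_set f !=set0.
  move=> Jf; apply/set0P/eqP => /contC_unit[g gf]; apply: J1; rewrite -gf.
  exact: (JM _ _ Jf).1.
have FF : ProperFilter F.
  apply: filter_from_proper => //; apply: filter_from_filter; first by exists 0.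
  move=> f g Jf Jg.
  have conj_cont (h : CX) : continuous (fun x => conjc (contC_fun h x)).
    move=> x; apply: (@continuous_comp _ _ _ (contC_fun h) (@conjc R)).
      exact: contC_continuous.
    exact: conjc_continuous.
  exists (mk_contC (conj_cont f) * f + mk_contC (conj_cont g) * g).
    by apply: JD; [exact: (JM _ _ Jf).1|exact: (JM _ _ Jg).1].
  move=> x; rewrite /zero_set /mkset contCDE !contCME /contC_fun /=.
  rewrite ![_^*%C * _]mulrC -!sqr_normc => /eqP.
  rewrite paddr_eq0 ?exprn_ge0 // !sqrf_eq0 !normr_eq0.
  by move=> /andP[/eqP ? /eqP ?].
have [x [_ clx]] := cX F FF filterT.
exists x => f Jf.
have : closure (zero_set f) x.
  by move=> B nB; apply: clx => //; exists f.
by rewrite -(closure_id (zero_set f)).1 //; exact: closed_zero_set.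
Qed.

Lemma contC_separates (V : set X) (y : X) : compact [set: X] ->
  hausdorff_space X -> closed V -> ~ V y ->
  exists f : CX, (forall x, V x -> contC_fun f x = 0) /\ contC_fun f y = 1.
Proof.
move=> cX hX clV Vy.
have nX := compact_normal hX cX.
have cly : closed [set y].
  by apply: accessible_closed_set1; exact: hausdorff_accessible.
have : uniform_separator V [set y].
  apply: normal_uniform_separator => //.
  by apply/seteqP; split=> // z [Vz zy]; apply: Vy; rewrite -zy.
move=> /(@uniform_separatorP _ R)[f [cf _ fV fy]].
have cf' : continuous (fun x => ((f x)%:C)%C : R[i]).
  move=> x; apply: (@continuous_comp _ _ _ f (fun r : R => (r%:C)%C : R[i])).
    exact: cf.
  exact: real_complex_continuous.
exists (mk_contC cf'); split => [x Vx|].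
  by change ((f x)%:C%C = 0); rewrite (fV (f x)) //; exists x.
by change ((f y)%:C%C = 1); rewrite (fy (f y)) //; exists y.
Qed.

End ContinuousFunctions.

Lemma contC_neq0 (R : realType) (X : topologicalType) :
  [set: X] !=set0 -> (1 : contC R X) <> 0.
Proof.
move=> [x _] /(congr1 (fun f => contC_fun f x))/eqP.
by rewrite contC1E contC0E oner_eq0.
Qed.

(** * Minimality and faithfulness of a transformation group *)

Section TransformationGroups.
Context (R : realType) (XG : transformationGroup).
Local Notation X := (tg_space XG).
Local Notation G := (tg_group XG).
Local Notation CX := (contC R X).
Local Notation sigma := (tg_sigma XG R).

Lemma tg_sigmaE g (f : CX) x :
  contC_fun (sigma g f) x = contC_fun f (tg_act g^-1%g x).
Proof. by []. Qed.

(** The common zeros of a proper invariant ideal form a nonempty closed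
    invariant set, so by minimality every function in the ideal vanishes. *)
Lemma minimal_G_simple : tg_minimal XG -> G_simple sigma.
Proof.
move=> minX J Jid Jinv; have [J1|J1] := EM (J 1).
  right; apply/seteqP; split=> // f _; rewrite -[f]mulr1.
  by case: Jid => _ _ /(_ f 1 J1)[].
left; apply/seteqP; split=> [f Jf|_ ->]; last by case: Jid.
apply/contCP => x; rewrite contC0E.
pose V := [set y | forall h, J h -> contC_fun h y = 0].
suff VT : V = setT by have /(_ f Jf) : V x by rewrite VT.
apply: minX.
- by have [y Vy] := proper_ideal_common_zero (@tg_compact XG) Jid J1; exists y.
- have -> : V = \bigcap_(h in J) zero_set h by [].
  by apply: closed_bigI => h _; exact: closed_zero_set.
- move=> g _ [y Vy <-] h Jh.
  have := Vy (sigma g^-1%g h); rewrite tg_sigmaE invgK; apply.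
  by apply: (Jinv g^-1%g); exists h.
Qed.

(** The functions vanishing on V form an invariant ideal, which cannot be 0
    when a continuous function separates V from a point outside. *)
Lemma G_simple_minimal : G_simple sigma -> tg_minimal XG.
Proof.
move=> Gsim V [x0 Vx0] clV Vinv.
pose J := [set f : CX | forall x, V x -> contC_fun f x = 0].
have [|g _ [f Jf <-] x Vx|JE|JT] := Gsim J.
- split=> [x _|f h Jf Jh x Vx|h f Jf] //.
    by rewrite contCDE Jf ?Jh ?addr0.
  by split=> x Vx; rewrite contCME Jf ?mulr0 ?mul0r.
- by rewrite tg_sigmaE Jf //; apply: (Vinv g^-1%g); exists x.
- apply/seteqP; split=> // y _; apply: contrapT => Vy.
  have [f [fV fy]] := @contC_separates R _ _ y (@tg_compact XG)
    (@tg_hausdorff XG) clV Vy.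
  have : J f by [].
  rewrite JE => f0; move: fy; rewrite f0 contC0E => /esym/eqP.
  by rewrite oner_eq0.
- have : J 1 by rewrite JT.
  by move=> /(_ x0 Vx0)/eqP; rewrite contC1E oner_eq0.
Qed.

Lemma tg_sigma_injectiveP : tg_sigma_injective XG R <->
  forall g, (forall f, sigma g f = f) -> g = 1%g.
Proof.
rewrite /tg_sigma_injective; cbv zeta; split=> [inj g gid|inj g h gh].
  by apply: inj => f; rewrite gid ring_act1.
have : (h^-1 * g)%g = 1%g.
  by apply: inj => f; rewrite ring_actM gh -ring_actM mulVg ring_act1.
by move=> /(congr1 (fun k => (h * k)%g)); rewrite mulVKg mulg1.
Qed.

(** A continuous function separates x from any other point of its orbit. *)
Lemma faithful_sigma_injective : tg_faithful XG <-> tg_sigma_injective XG R.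
Proof.
rewrite tg_sigma_injectiveP; split=> [fX g gid|inj g g1].
  apply: contrapT => g1; have [|x gx] := fX g^-1%g.
    by move=> /(congr1 (fun k => k^-1%g)); rewrite invgK invg1.
  have cl1 : closed [set x].
    apply: accessible_closed_set1; apply: hausdorff_accessible.
    exact: tg_hausdorff.
  have [f [fV fy]] := @contC_separates R _ _ (tg_act g^-1%g x)
    (@tg_compact XG) (@tg_hausdorff XG) cl1 gx.
  have := tg_sigmaE g f x; rewrite gid fy fV // => /esym/eqP.
  by rewrite oner_eq0.
apply: contrapT => nfix; apply: g1; apply: inj => f; apply/contCP => x.
rewrite tg_sigmaE; congr contC_fun.
have gx y : tg_act g y = y by apply: contrapT => gy; apply: nfix; exists y.
by rewrite -[in LHS](gx x) -tg_actM mulVg tg_act1.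
Qed.

Lemma minimal_faithfulP : G_simple sigma /\ tg_sigma_injective XG R <->
  tg_minimal XG /\ tg_faithful XG.
Proof.
rewrite faithful_sigma_injective; split=> -[sX iX]; split=> //.
  exact: G_simple_minimal.
exact: minimal_G_simple.
Qed.

End TransformationGroups.

(** * The discrete group of homeomorphisms of a space *)

Lemma discrete_continuous (D : discreteTopologicalType) (Y : topologicalType)
  (f : D -> Y) : continuous f.
Proof.
move=> d B nB; apply: filterS (discrete_set1 d) => _ ->.
exact: (nbhs_singleton nB).
Qed.

Lemma discrete_uncurry_continuous (D : discreteTopologicalType)
    (Y Z : topologicalType) (f : D -> Y -> Z) :
  (forall d, continuous (f d)) -> continuous (fun p : D * Y => f p.1 p.2).
Proof.
move=> cf [d y] B nB; exists ([set d], f d @^-1` B).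
  by split; [exact: discrete_set1|exact: cf].
by move=> [_ z] [/= -> ].
Qed.

Section Homeomorphisms.
Context (X : topologicalType).

(** The inverse is part of the data so that the group operations are
    definable; it is determined by the map (homeoP). *)
Record homeo := Homeo {
  homeo_fun : X -> X;
  homeo_inv : X -> X;
  homeo_funK : cancel homeo_fun homeo_inv;
  homeo_invK : cancel homeo_inv homeo_fun;
  homeo_continuous : continuous homeo_fun;
  homeo_inv_continuous : continuous homeo_inv
}.

Lemma homeoP g h : homeo_fun g =1 homeo_fun h -> g = h.
Proof.
case: g h => [g g' gK g'K cg cg'] [h h' hK h'K ch ch'] /= /funext gh.
subst h; have gh' : g' = h'.
  by apply/funext => x; rewrite -[in LHS](h'K x) gK.
by subst h'; congr Homeo; exact: Prop_irrelevance.
Qed.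

HB.instance Definition _ := gen_eqMixin homeo.
HB.instance Definition _ := gen_choiceMixin homeo.

Let one : homeo :=
  @Homeo id id (fun=> erefl) (fun=> erefl) (fun=> cvg_id) (fun=> cvg_id).

Let inv (g : homeo) : homeo :=
  Homeo (@homeo_invK g) (@homeo_funK g)
    (@homeo_inv_continuous g) (@homeo_continuous g).

Let comp_continuous (f g : X -> X) :
  continuous f -> continuous g -> continuous (f \o g).
Proof. by move=> cf cg x; apply: continuous_comp; [exact: cg|exact: cf]. Qed.

Let mul (g h : homeo) : homeo :=
  Homeo (can_comp (@homeo_funK g) (@homeo_funK h))
    (can_comp (@homeo_invK h) (@homeo_invK g))
    (comp_continuous (@homeo_continuous g) (@homeo_continuous h))
    (comp_continuous (@homeo_inv_continuous h) (@homeo_inv_continuous g)).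

Let mulA : associative mul. Proof. by move=> g h k; exact: homeoP. Qed.
Let mul1 : left_id one mul. Proof. by move=> g; exact: homeoP. Qed.
Let mulx1 : right_id one mul. Proof. by move=> g; exact: homeoP. Qed.
Let mulV : left_inverse one inv mul.
Proof. by move=> g; apply: homeoP => x; exact: homeo_funK. Qed.
Let mulxV : right_inverse one inv mul.
Proof. by move=> g; apply: homeoP => x; exact: homeo_invK. Qed.

HB.instance Definition _ := isGroup.Build homeo mulA mul1 mulx1 mulV mulxV.

HB.instance Definition _ := hasNbhs.Build homeo principal_filter.
HB.instance Definition _ := Discrete_ofNbhs.Build homeo erefl.

Let mulg_continuous : continuous (fun p : homeo * homeo => (p.1 * p.2)%g).
Proof.
apply: (@discrete_uncurry_continuous _ _ _ (fun g h : homeo => (g * h)%g)).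
by move=> g; exact: discrete_continuous.
Qed.

Let invg_continuous : continuous (fun g : homeo => g^-1%g).
Proof. exact: discrete_continuous. Qed.

HB.instance Definition _ :=
  isTopologicalGroup.Build homeo mulg_continuous invg_continuous.

Hypothesis cX : compact [set: X].
Hypothesis hX : hausdorff_space X.

Definition homeo_group : transformationGroup :=
  @TransformationGroup X homeo cX hX homeo_fun (fun=> erefl)
    (fun _ _ _ => erefl)
    (discrete_uncurry_continuous (@homeo_continuous)).

Lemma homeo_group_faithful : tg_faithful homeo_group.
Proof.
move=> g g1; apply: contrapT => gx; apply: g1; apply: homeoP => x.
by apply: contrapT => gxx; apply: gx; exists x.
Qed.

Lemma homeo_group_minimal : (forall x y, exists g, homeo_fun g x = y) ->
  tg_minimal homeo_group.
Proof.
move=> trX V [x Vx] _ Vinv; apply/seteqP; split=> // y _.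
by have [g <-] := trX x y; apply: (Vinv g); exists x.
Qed.

End Homeomorphisms.

(** * Homeomorphisms of the Cantor space *)

Lemma cantor_near_coord (x : cantor_space) k : \forall y \near x, y k = x k.
Proof.
have := @proj_continuous nat (fun=> bool) k x.
by move=> /(_ [set x k]); apply; exact: discrete_set1.
Qed.

(** Continuity into a product of discrete spaces: each coordinate of the image
    is locally constant. *)
Lemma cantor_map_continuous (f : cantor_space -> cantor_space) :
  (forall x k, \forall y \near x, f y k = f x k) -> continuous f.
Proof.
move=> cf x; apply/cvg_sup => k.
move=> B [_ [[W oW <-] Wx WB]]; apply: filterS (cf x k) => y fy.
by apply: WB; rewrite /= fy.
Qed.

Section CantorHomeo.
Implicit Types x y : cantor_space.

Let translation_fun x y : cantor_space := fun k => y k (+) x k.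

Let translationK x : involutive (translation_fun x).
Proof. by move=> y; apply/funext => k; rewrite /translation_fun addbK. Qed.

Let translation_continuous x : continuous (translation_fun x).
Proof.
apply: cantor_map_continuous => y k; apply: filterS (cantor_near_coord y k).
by move=> z zk; rewrite /translation_fun zk.
Qed.

Definition translation x : homeo cantor_space :=
  Homeo (translationK x) (translationK x)
    (@translation_continuous x) (@translation_continuous x).

(** Invert coordinate n of the points whose coordinate p is c: when p and n
    differ this is an involution fixing all other points. *)
Let flip_fun n p (c : bool) y : cantor_space :=
  fun k => y k (+) ((k == n) && (y p == c)).

Let flipK n p c : p != n -> involutive (flip_fun n p c).
Proof.
move=> pn y; apply/funext => k.
by rewrite /flip_fun (negbTE pn) addbF addbK.
Qed.

Let flip_continuous n p c : continuous (flip_fun n p c).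
Proof.
apply: cantor_map_continuous => y k.
apply: filterS2 (cantor_near_coord y k) (cantor_near_coord y p).
by move=> z zk zp; rewrite /flip_fun zk zp.
Qed.

Definition flip n p c (pn : p != n) : homeo cantor_space :=
  Homeo (flipK c pn) (flipK c pn)
    (@flip_continuous n p c) (@flip_continuous n p c).

Lemma translation_transitive x y : exists g, homeo_fun g x = y.
Proof.
exists (translation (fun k => x k (+) y k)); apply/funext => k.
by rewrite /= /translation_fun addbA addbb.
Qed.

Lemma flipE n p c (pn : p != n) y k :
  homeo_fun (flip c pn) y k = y k (+) ((k == n) && (y p == c)).
Proof. by []. Qed.

Lemma flip_id n p c (pn : p != n) y : y p != c -> homeo_fun (flip c pn) y = y.
Proof.
by move=> yp; apply/funext => k; rewrite flipE (negbTE yp) andbF addbF.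
Qed.

(** If g moves x, some coordinate p separates x from g x.  The flips s_n of
    the various coordinates other than p, conditioned on agreeing with x at p,
    move x to distinct points and fix g x; the conjugate of g by s_n sends
    s_n x to g x, so distinct s_n give distinct conjugates. *)
Lemma homeo_cantor_infinite_conjugacy (g : homeo cantor_space) : g <> 1%g ->
  exists s : nat -> homeo cantor_space,
    injective (fun n => s n * g * (s n)^-1)%g.
Proof.
move=> g1.
have [x gx] : exists x, homeo_fun g x <> x.
  apply: contrapT => nx; apply: g1; apply: homeoP => x.
  by apply: contrapT => gx; apply: nx; exists x.
have [p gxp] : exists p, homeo_fun g x p != x p.
  apply: contrapT => np; apply: gx; apply/funext => p.
  by apply: contrapT => /eqP gxp; apply: np; exists p.
(* n |-> bump p n enumerates the coordinates other than p *)
pose s n := flip (x p) (neq_bump p n).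
exists s => n m nm.
have sg k : homeo_fun (s k * g * (s k)^-1)%g (homeo_fun (s k) x) =
    homeo_fun g x.
  have -> : homeo_fun (s k * g * (s k)^-1)%g (homeo_fun (s k) x) =
      homeo_fun (s k) (homeo_fun g (homeo_inv (s k) (homeo_fun (s k) x))).
    by [].
  by rewrite homeo_funK flip_id.
have : homeo_fun (s n) x = homeo_fun (s m) x.
  by apply: (can_inj (homeo_funK (s m * g * (s m)^-1)%g)); rewrite sg -nm sg.
move=> /(congr1 (fun y => y (bump p n))); rewrite !flipE !eqxx /= andbT.
by move=> /addbI /esym/eqP /(can_inj (bumpK p)).
Qed.

End CantorHomeo.

Definition cantor_group : transformationGroup :=
  homeo_group cantor_space_compact cantor_space_hausdorff.

(** The homeomorphism inverting coordinate 1 where coordinate 0 is true fixes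
    the clopen set where coordinate 0 is false, so the indicator function of
    that set satisfies the commutation relation at this homeomorphism. *)
Lemma cantor_group_not_maximal_commutative (R : realType) :
  ~ maximal_commutative (base_subring (tg_sigma cantor_group R)).
Proof.
move=> /maximal_commutativeP mc.
have cr : continuous (fun y : cantor_space => if y 0%N then 0 else 1 : R[i]).
  move=> y; apply: cvg_near_cst; apply: filterS (cantor_near_coord y 0%N).
  by move=> z /= ->.
have crE (y : cantor_space) :
    contC_fun (mk_contC cr) y = if y 0%N then 0 else 1 by [].
pose s : homeo cantor_space := flip true (isT : 0%N != 1%N).
have s1 : s <> 1%g.
  move=> /(congr1 (fun g => homeo_fun g ((fun=> true) : cantor_space) 1%N)).
  by rewrite flipE.
have r0 : mk_contC cr = 0 :> contC R cantor_space.
  apply: (mc s) => // a; apply/contCP => y.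
  rewrite !contCME tg_sigmaE.
  have -> : tg_act (s : tg_group cantor_group)^-1%g y = homeo_fun s y by [].
  rewrite crE; case: ifPn => y0; first by rewrite mulr0 mul0r.
  by rewrite flip_id ?eqb_id // mulr1 mul1r.
have := crE (fun=> false).
by rewrite r0 contC0E => /esym/eqP; rewrite oner_eq0.
Qed.

(** * The five assertions *)

Theorem theorem1p3 (R : realType) :
  let i (XG : transformationGroup) :=
    simple_algebra (skewGroupAlg (tg_sigma XG R)) in
  let ii (XG : transformationGroup) :=
    G_simple (tg_sigma XG R) /\ maximal_commutative (base_subring (tg_sigma XG R)) in
  let iii (XG : transformationGroup) :=
    G_simple (tg_sigma XG R) /\
      is_field (ring_center (skewGroupAlg (tg_sigma XG R))) in
  let iv (XG : transformationGroup) :=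
    G_simple (tg_sigma XG R) /\ tg_sigma_injective XG R in
  let v (XG : transformationGroup) :=
    tg_minimal XG /\ tg_faithful XG in
  [/\ (* (a) *)
      forall XG : transformationGroup, [set: tg_space XG] !=set0 ->
        (i XG <-> ii XG) /\ (i XG -> [/\ iii XG, iv XG & v XG]),
      (* (b) *)
      forall XG : transformationGroup, [set: tg_space XG] !=set0 ->
        (iv XG <-> v XG),
      (* (c) *)
      exists XG : transformationGroup, [set: tg_space XG] !=set0 /\
        [/\ iii XG, iv XG, v XG, ~ i XG & ~ ii XG] &
      (* (d) *)
      forall XG : transformationGroup, [set: tg_space XG] !=set0 ->
        (forall g h : tg_group XG, (g * h = h * g)%g) ->
        [<-> i XG; ii XG; iii XG; iv XG; v XG]].
Proof.
move=> i ii iii iv v.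
have base (XG : transformationGroup) : [set: tg_space XG] !=set0 ->
    (i XG <-> ii XG) /\ (i XG -> [/\ iii XG, iv XG & v XG]).
  move=> X0; have C1 := @contC_neq0 R _ X0.
  have i_ii : i XG <-> ii XG by exact: simpleP.
  split=> // /i_ii[Gsim mc].
  have ivXG : iv XG.
    split=> //; apply/tg_sigma_injectiveP => g.
    exact: maximal_commutative_faithful.
  split=> //; last exact: (minimal_faithfulP R XG).1.
  split=> //; apply: center_field => //.
  exact: maximal_commutative_center_base.
split=> // [XG _||XG X0 Gcomm].
- exact: minimal_faithfulP.
- have X0 : [set: tg_space cantor_group] !=set0.
    by exists ((fun=> false) : cantor_space).
  have vXG : v cantor_group.
    split; last exact: homeo_group_faithful.
    apply: homeo_group_minimal; exact: translation_transitive.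
  have ivXG : iv cantor_group by exact: (minimal_faithfulP R cantor_group).2.
  have nii : ~ ii cantor_group.
    by case=> _; exact: cantor_group_not_maximal_commutative.
  exists cantor_group; split=> //; split=> //; last by move/(base _ X0).1.
  split; first by case: ivXG.
  apply: center_field; [exact: contC_neq0|by case: ivXG|].
  apply: infinite_conjugacy_center_base.
  exact: homeo_cantor_infinite_conjugacy.
- have C1 := @contC_neq0 R _ X0; have [i_ii i_all] := base XG X0.
  tfae.
  + by move/i_ii.
  + by move/i_ii/i_all=> [].
  + move=> [Gsim cf]; split=> //; apply/tg_sigma_injectiveP => g.
    exact: abelian_center_field_faithful.
  + exact: (minimal_faithfulP R XG).1.
  + move/(minimal_faithfulP R XG).2 => [Gsim inj]; apply/i_ii; split=> //.
    apply: abelian_maximal_commutative => //.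
    exact: (tg_sigma_injectiveP R XG).1.
Qed.
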